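(* Let $d\ge 1$ be an integer, and let $R=(R_{ijk})_{1\le i,j,k\le d}$ be a collection of real numbers satisfying the following three assumptions: (T) $R_{ijk}\ge 0$ for all $1\le i,j,k\le d$; (B) there exists $\sigma\in(0,\infty)$ such that $\sum_{i=1}^d R_{ijk}=\sigma$ for all $1\le j,k\le d$; (E) $\max_{1\le j,j',k,k'\le d}\sum_{i=1}^d |R_{ijk}-R_{ij'k'}|<\sigma$. Let $(U(n))_{n\ge 0}$ be a $2$-drawing $d$-colour Pólya urn with replacement tensor $R$. Then: (i) there exists a unique $x^*\in\Delta_d$ such that $\sigma x^*=\mathcal R(x^*,x^* )$; and (ii) as long as $\|U(0)\|_1>0$, one has $\dfrac{U(n)}{\|U(n)\|_1}\to x^*$ in probability as $n\to\infty$.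
   Context: $\Delta_d=\{x\in[0,1]^d : \|x\|_1=1\}$, where $\|x\|_1=\sum_{i=1}^d|x_i|$. The collection $R$ defines a bilinear map $\mathcal R:\mathbb R^d\times\mathbb R^d\to\mathbb R^d$ by $\mathcal R(x,y)=(\mathcal R_1(x,y),\dots,\mathcal R_d(x,y))$ with $\mathcal R_k(x,y)=\sum_{i=1}^d\sum_{j=1}^d R_{kij}\,x_iy_j$. The $2$-drawing $d$-colour Pólya urn with replacement tensor $R$ is a stochastic process $(U(n)=(U_1(n),\dots,U_d(n)))_{n\ge 0}$ with values in $[0,\infty)^d$, with deterministic initial value $U(0)$, such that for all $n\ge 0$ and $1\le i\le d$, $$U_i(n+1)=U_i(n)+R_{i\,C_1(n)\,C_2(n)},$$ where, conditionally on $U(0),\dots,U(n)$ (and on the previous draws), $C_1(n)$ and $C_2(n)$ are independent and identically distributed on $\{1,\dots,d\}$ with $\mathbb P(C_1(n)=k)=\mathbb P(C_2(n)=k)=U_k(n)/\sum_{i=1}^d U_i(n)$ for all $1\le k\le d$. *)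

(* Defs.v *)
From HB Require Import structures.
From mathcomp Require Import all_boot all_order all_algebra.
From mathcomp Require Import all_classical all_reals all_analysis.

Set Implicit Arguments.
Unset Strict Implicit.
Unset Printing Implicit Defensive.

Import Order.TTheory GRing.Theory Num.Theory.
Import numFieldNormedType.Exports.

Local Open Scope classical_set_scope.
Local Open Scope ring_scope.

Section Vectors.
Context {R : realType} {d : nat}.

Definition l1norm (x : 'rV[R]_d) : R := \sum_(i < d) `|x ord0 i|.

Definition simplex : set 'rV[R]_d :=
  [set x : 'rV[R]_d | (forall i, 0 <= x ord0 i <= 1) /\ l1norm x = 1].

(* [W i j k] is the amount added to colour [i] when the ordered pair of
   colours [(j, k)] is drawn. *)
Definition replacement_tensor := 'I_d -> 'I_d -> 'I_d -> R.

Definition replacement_map (W : replacement_tensor) (x y : 'rV[R]_d) :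
    'rV[R]_d :=
  \row_k \sum_(i < d) \sum_(j < d) W k i j * x ord0 i * y ord0 j.

(* All the terms are nonnegative, so for [0 < d] taking 0 as the default value
   of the iterated maximum does not affect the result. *)
Definition tensor_spread (W : replacement_tensor) : R :=
  \big[Num.max/0]_(j < d) \big[Num.max/0]_(j' < d)
  \big[Num.max/0]_(k < d) \big[Num.max/0]_(k' < d)
    \sum_(i < d) `|W i j k - W i j' k'|.

End Vectors.
Arguments replacement_tensor : clear implicits.

Section Conditioning.
Context {R : realType} {disp : measure_display} {T : measurableType disp}.
Variable P : probability T R.

(* [f] is a version of the conditional probability P(E | F), where [F] is a
   sub-sigma-algebra of the measurable sets of [T]. *)
Definition is_cond_prob (F : set (set T)) (E : set T) (f : T -> R) : Prop :=
  [/\ forall B : set R, measurable B -> F (f @^-1` B),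
      P.-integrable setT (EFin \o f) &
      forall A, F A -> (\int[P]_(w in A) (f w)%:E = P (E `&` A))%E].

Definition cvg_in_probability {d : nat} (X : nat -> T -> 'rV[R]_d)
    (x : 'rV[R]_d) : Prop :=
  forall eps : R, 0 < eps ->
    P [set w | eps < l1norm (X n w - x)] @[n --> \oo] --> (0 : \bar R)%E.

End Conditioning.

Section Urn.
Context {R : realType} {d : nat} {disp : measure_display}
  {T : measurableType disp}.
Implicit Types (U : nat -> T -> 'rV[R]_d) (C : nat -> T -> 'I_d).

(* The sigma-algebra generated by U(0), ..., U(n) and by the draws made at the
   steps 0, ..., n - 1. *)
Definition urn_history U C1 C2 (n : nat) : set (set T) :=
  <<s [set A | exists m i (B : set R), [/\ (m <= n)%N, measurable B &
                 A = (fun w => U m w ord0 i) @^-1` B]]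
      `|` [set A | exists m k, (m < n)%N /\
                 (A = C1 m @^-1` [set k] \/ A = C2 m @^-1` [set k])] >>.

Definition proportion (u : 'rV[R]_d) (k : 'I_d) : R :=
  u ord0 k / \sum_(i < d) u ord0 i.

Record two_drawing_urn (W : replacement_tensor R d) (P : probability T R)
    (u0 : 'rV[R]_d) U C1 C2 : Prop := {
  urn_measurable : forall n i, measurable_fun setT (fun w => U n w ord0 i) ;
  draw1_measurable : forall n k, measurable (C1 n @^-1` [set k]) ;
  draw2_measurable : forall n k, measurable (C2 n @^-1` [set k]) ;
  urn_ge0 : forall n w i, 0 <= U n w ord0 i ;
  urn_init : forall w, U 0%N w = u0 ;
  urn_step : forall n w i,
    U n.+1 w ord0 i = U n w ord0 i + W i (C1 n w) (C2 n w) ;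
  draw1_law : forall n k,
    is_cond_prob P (urn_history U C1 C2 n) (C1 n @^-1` [set k])
      (fun w => proportion (U n w) k) ;
  draw2_law : forall n k,
    is_cond_prob P (urn_history U C1 C2 n) (C2 n @^-1` [set k])
      (fun w => proportion (U n w) k) ;
  (* conditional independence: the conditional joint law is the product of the
     conditional marginal laws above *)
  draws_independent : forall n k l,
    is_cond_prob P (urn_history U C1 C2 n)
      (C1 n @^-1` [set k] `&` C2 n @^-1` [set l])
      (fun w => proportion (U n w) k * proportion (U n w) l)
}.

End Urn.

(* Main.v *)
Require Import Defs.
From HB Require Import structures.
From mathcomp Require Import all_boot all_order all_algebra.
From mathcomp Require Import all_classical all_reals all_analysis.
From mathcomp Require Import ring lra.

Set Implicit Arguments.
Unset Strict Implicit.
Unset Printing Implicit Defensive.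

Import Order.TTheory GRing.Theory Num.Theory.
Import numFieldNormedType.Exports.

Local Open Scope classical_set_scope.
Local Open Scope ring_scope.

(** Write X(n) = U(n) / |U(n)|_1 and F(x) = R(x,x), and let rho be the spread
    of the replacement tensor, so that rho < sigma.

    For x in the simplex, x (x) x is a probability on pairs of colours, and F
    maps it linearly.  The difference of two such probabilities has total mass
    zero and l1 norm at most 2 |x - y|_1, and a zero-sum combination of columns
    at mutual l1 distance at most rho has l1 norm at most rho/2 times the l1
    norm of the coefficients ([zero_sum_contraction]).  Hence F is
    rho-Lipschitz on the simplex for the l1 norm
    ([replacement_map_lipschitz]), and F / sigma is a contraction of the
    simplex into itself.  This gives uniqueness of the fixed point z;
    existence follows by minimising |F(x) - sigma x|_1 over the compact
    simplex, as applying F / sigma to a minimiser with nonzero value would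
    decrease that value.

    For the convergence, the total mass S(n) = |U(0)|_1 + sigma n is
    deterministic.  Let G(n) be the sum of the martingale increments
    W(C1(m),C2(m)) - F(X(m)) for m < n.  The increments are bounded by sigma in
    each coordinate and centred given the past, so E G_i(n)^2 <= sigma^2 n and
    E |G(n)|_1 = O(sqrt S(n)).  The l1 norm is not smooth, so the noise is
    subtracted instead of being expanded: V(n) = U(n) - S(n) z - G(n)
    satisfies the noiseless recursion V(n+1) = V(n) + F(X(n)) - F(z), while
    X(n) - z = (V(n) + G(n)) / S(n).  The Lipschitz bound then yields, for
    a(n) = E |V(n)|_1 / S(n),
      a(n+1) <= (1 - g(n)) a(n) + g(n) e(n),
    with g(n) = (sigma - rho) / S(n+1) and e(n) = O(S(n)^(-1/2)).  As the g(n)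
    have a divergent sum and e(n) tends to 0, a(n) tends to 0
    ([cvg0_damped_recursion]).  Therefore E |X(n) - z|_1 tends to 0
    ([mean_deviation_cvg0]), and the Markov inequality concludes.

    The urn is a function of the finite sequence of draws, so every
    expectation above is a finite sum over such sequences; the probability
    space only enters through the law of the draws ([prob_draw_path]) and the
    final Markov bound ([prob_path_le]). *)

(** * Contraction of the replacement map and its fixed point *)

Section Contraction.
Context {R : realType}.

(** With p and q the positive and negative parts of the weights [a], both of
    mass M = (sum of |a|) / 2, M times the combination is the sum over (j, j')
    of p_j q_j' (r_j - r_j'), of norm at most s M^2. *)
Lemma zero_sum_contraction (I J : finType) (a : J -> R) (r : J -> I -> R)
    (s : R) :
  \sum_j a j = 0 ->
  (forall j j', \sum_i `|r j i - r j' i| <= s) ->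
  2 * (\sum_i `|\sum_j a j * r j i|) <= s * \sum_j `|a j|.
Proof.
move=> a0 rs; set m := \sum_j `|a j|.
pose p j := (`|a j| + a j) / 2; pose q j := (`|a j| - a j) / 2.
have p_ge0 j : 0 <= p j.
  by rewrite divr_ge0// -lerBlDr sub0r -normrN ler_norm.
have q_ge0 j : 0 <= q j by rewrite divr_ge0// subr_ge0 ler_norm.
have sp : \sum_j p j = m / 2 by rewrite -mulr_suml big_split/= a0 addr0.
have sq : \sum_j q j = m / 2.
  by rewrite -mulr_suml big_split/= sumrN a0 subr0.
have [m0|m_neq0] := eqVneq m 0.
  have az j : a j = 0.
    apply/eqP; rewrite -normr_eq0; apply/eqP.
    by move: (j) isT; apply/psumr_eq0P.
  rewrite m0 mulr0 big1 ?mulr0// => i _.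
  by rewrite big1 ?normr0// => j _; rewrite az mul0r.
have m_gt0 : 0 < m by rewrite lt_def m_neq0 sumr_ge0.
have key i : m / 2 * \sum_j a j * r j i =
    \sum_j \sum_j' p j * q j' * (r j i - r j' i).
  under [RHS]eq_bigr do under eq_bigr do rewrite mulrBr.
  under [RHS]eq_bigr do rewrite sumrB.
  rewrite sumrB [X in _ - X]exchange_big/=.
  rewrite [X in X - _](_ : _ = m / 2 * \sum_j p j * r j i); last first.
    rewrite mulr_sumr; apply: eq_bigr => j _.
    by rewrite -sq !mulr_suml; apply: eq_bigr => k _; ring.
  rewrite [X in _ - X](_ : _ = m / 2 * \sum_j q j * r j i); last first.
    rewrite mulr_sumr; apply: eq_bigr => j _.
    by rewrite -sp !mulr_suml; apply: eq_bigr => k _; ring.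
  rewrite -mulrBr -sumrB; congr (_ * _); apply: eq_bigr => j _.
  by rewrite /p /q; field.
rewrite -(@ler_pM2l _ (m / 2))// ?divr_gt0//.
have -> : m / 2 * (2 * \sum_i `|\sum_j a j * r j i|) =
    2 * \sum_i `|m / 2 * \sum_j a j * r j i|.
  rewrite mulrCA mulr_sumr; congr (_ * _); apply: eq_bigr => i _.
  by rewrite normrM [`|m / 2|]ger0_norm// divr_ge0// ltW.
have -> : m / 2 * (s * m) = 2 * (m / 2 * (m / 2) * s) by field.
rewrite ler_pM2l//.
have -> : m / 2 * (m / 2) * s = \sum_j \sum_j' p j * q j' * s.
  rewrite -{1}sp -sq !mulr_suml; apply: eq_bigr => j _.
  by rewrite mulr_sumr mulr_suml.
under eq_bigr do rewrite key.
apply: (@le_trans _ _ (\sum_i \sum_j \sum_j' p j * q j' * `|r j i - r j' i|)).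
  apply: ler_sum => i _; rewrite (le_trans (ler_norm_sum _ _ _))//.
  apply: ler_sum => j _; rewrite (le_trans (ler_norm_sum _ _ _))//.
  apply: ler_sum => j' _.
  by rewrite normrM [`|p j * q j'|]ger0_norm// mulr_ge0.
rewrite exchange_big/=; apply: ler_sum => j _.
rewrite exchange_big/=; apply: ler_sum => j' _.
by rewrite -mulr_sumr ler_wpM2l// mulr_ge0.
Qed.

Context {d : nat}.
Implicit Types (x y : 'rV[R]_d) (W : replacement_tensor R d).

Lemma rowBE x y i : (x - y) ord0 i = x ord0 i - y ord0 i.
Proof. by rewrite !mxE. Qed.

Lemma rowZE (t : R) x i : (t *: x) ord0 i = t * x ord0 i.
Proof. by rewrite mxE. Qed.

Lemma tensor_spread_ge W j j' k k' :
  \sum_(i < d) `|W i j k - W i j' k'| <= tensor_spread W.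
Proof.
apply: (bigmax_sup j) => //; apply: (bigmax_sup j') => //.
by apply: (bigmax_sup k) => //; apply: (bigmax_sup k').
Qed.

Lemma tensor_spread_ge0 W : 0 <= tensor_spread W.
Proof. exact: bigmax_ge_id. Qed.

Lemma replacement_mapE W x k : replacement_map W x x ord0 k =
  \sum_(c : 'I_d * 'I_d) x ord0 c.1 * x ord0 c.2 * W k c.1 c.2.
Proof.
rewrite mxE pair_big/=; apply: eq_bigr => c _.
by rewrite -mulrA mulrC.
Qed.

Lemma simplex_ge0 x i : simplex x -> 0 <= x ord0 i.
Proof. by case=> /(_ i)/andP[]. Qed.

Lemma simplex_sum x : simplex x -> \sum_(i < d) x ord0 i = 1.
Proof.
move=> xS; rewrite -xS.2; apply: eq_bigr => i _.
by rewrite ger0_norm// simplex_ge0.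
Qed.

Lemma simplex_intro x :
  (forall i, 0 <= x ord0 i) -> \sum_(i < d) x ord0 i = 1 -> simplex x.
Proof.
move=> x0 x1; split=> [i|]; last first.
  by rewrite -x1; apply: eq_bigr => i _; rewrite ger0_norm.
by rewrite x0 -x1 (bigD1 i)//= lerDl sumr_ge0.
Qed.

Lemma simplex_sum_pair x : simplex x ->
  \sum_(c : 'I_d * 'I_d) x ord0 c.1 * x ord0 c.2 = 1.
Proof.
move=> xS.
rewrite -(pair_big xpredT xpredT (fun i j => x ord0 i * x ord0 j))/=.
under eq_bigr do rewrite -mulr_sumr simplex_sum// mulr1.
exact: simplex_sum.
Qed.

Lemma replacement_map_lipschitz W x y : simplex x -> simplex y ->
  l1norm (replacement_map W x x - replacement_map W y y) <=
  tensor_spread W * l1norm (x - y).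
Proof.
move=> xS yS.
(* [a] is the signed measure x (x) x - y (x) y on ordered pairs of colours. *)
pose a (c : 'I_d * 'I_d) := x ord0 c.1 * x ord0 c.2 - y ord0 c.1 * y ord0 c.2.
have a0 : \sum_c a c = 0 by rewrite sumrB !simplex_sum_pair// subrr.
have := @zero_sum_contraction _ _ a (fun c k => W k c.1 c.2) (tensor_spread W)
  a0 (fun c c' => tensor_spread_ge W _ _ _ _).
have -> : \sum_i `|\sum_c a c * W i c.1 c.2| =
    l1norm (replacement_map W x x - replacement_map W y y).
  apply: eq_bigr => i _; rewrite rowBE !replacement_mapE -sumrB.
  by congr `| _ |; apply: eq_bigr => c _; rewrite mulrBl.
have aE : \sum_c `|a c| <= 2 * l1norm (x - y).
  (* x_j x_k - y_j y_k = x_j (x_k - y_k) + (x_j - y_j) y_k *)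
  have -> : 2 * l1norm (x - y) = \sum_(c : 'I_d * 'I_d)
      (x ord0 c.1 * `|x ord0 c.2 - y ord0 c.2| +
       `|x ord0 c.1 - y ord0 c.1| * y ord0 c.2).
    rewrite big_split/= -(pair_big xpredT xpredT
      (fun i j => x ord0 i * `|x ord0 j - y ord0 j|))/=.
    rewrite -(pair_big xpredT xpredT
      (fun i j => `|x ord0 i - y ord0 i| * y ord0 j))/=.
    under eq_bigr do rewrite -mulr_sumr.
    under [X in _ = _ + X]eq_bigr do rewrite -mulr_sumr simplex_sum// mulr1.
    rewrite -mulr_suml simplex_sum// mul1r mulr_natl mulr2n.
    by congr (_ + _); apply: eq_bigr => i _; rewrite !mxE.
  apply: ler_sum => c _.
  have -> : a c = x ord0 c.1 * (x ord0 c.2 - y ord0 c.2) +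
      (x ord0 c.1 - y ord0 c.1) * y ord0 c.2 by rewrite /a; ring.
  rewrite (le_trans (ler_normD _ _))// !normrM.
  by rewrite (ger0_norm (simplex_ge0 _ xS)) (ger0_norm (simplex_ge0 _ yS)).
move=> le1; rewrite -(@ler_pM2l _ 2)// (le_trans le1)//.
by rewrite mulrCA ler_wpM2l// tensor_spread_ge0.
Qed.

Lemma l1norm_ge0 x : 0 <= l1norm x.
Proof. exact: sumr_ge0. Qed.

Lemma l1norm_eq0 x : l1norm x = 0 -> x = 0.
Proof.
move=> /psumr_eq0P x0; apply/rowP => i; rewrite mxE.
by apply/eqP; rewrite -normr_eq0 x0.
Qed.

Lemma l1normD x y : l1norm (x + y) <= l1norm x + l1norm y.
Proof.
by rewrite -big_split; apply: ler_sum => i _; rewrite mxE ler_normD.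
Qed.

Lemma l1normZ (t : R) x : l1norm (t *: x) = `|t| * l1norm x.
Proof. by rewrite mulr_sumr; apply: eq_bigr => i _; rewrite mxE normrM. Qed.

Lemma replacement_map_ge0 W x : (forall i j k, 0 <= W i j k) -> simplex x ->
  forall k, 0 <= replacement_map W x x ord0 k.
Proof.
move=> W0 xS k; rewrite replacement_mapE; apply: sumr_ge0 => c _.
by rewrite !mulr_ge0// simplex_ge0.
Qed.

Lemma replacement_map_sum W (sigma : R) x :
  (forall j k, \sum_(i < d) W i j k = sigma) -> simplex x ->
  \sum_k replacement_map W x x ord0 k = sigma.
Proof.
move=> hB xS; under eq_bigr do rewrite replacement_mapE.
rewrite exchange_big/=; under eq_bigr do rewrite -mulr_sumr hB.
by rewrite -mulr_suml simplex_sum_pair// mul1r.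
Qed.

Lemma fixed_point_unique W (sigma : R) x y : tensor_spread W < sigma ->
  simplex x -> sigma *: x = replacement_map W x x ->
  simplex y -> sigma *: y = replacement_map W y y -> x = y.
Proof.
move=> hE xS xE yS yE; apply/eqP; rewrite -subr_eq0; apply/eqP/l1norm_eq0.
have := replacement_map_lipschitz W xS yS.
rewrite -xE -yE -scalerBr l1normZ => le1.
apply/eqP; rewrite eq_le l1norm_ge0 andbT leNgt; apply/negP => gt0.
move: le1; rewrite ler_pM2r// leNgt => /negP; apply.
by rewrite (lt_le_trans hE)// ler_norm.
Qed.

Lemma continuous_l1norm (f : 'rV[R]_d -> 'rV[R]_d) :
  (forall i, continuous (fun x => f x ord0 i)) ->
  continuous (fun x => l1norm (f x)).
Proof.
move=> cf; apply: continuous_big => [|i _]; first exact: add_continuous.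
by move=> x; apply: continuous_comp; [exact: cf|exact: norm_continuous].
Qed.

Lemma compact_simplex : compact (@simplex R d).
Proof.
have clS : closed [set x : 'rV[R]_d | l1norm x = 1].
  apply: (@preimage_closed _ _ (@l1norm R d) [set 1]) => //.
  by move=> x _; apply: continuous_l1norm => i; exact: coord_continuous.
have cC := @rV_compact R d (fun=> `[0, 1]%classic)
  (fun=> @segment_compact R 0 1).
rewrite (_ : simplex = [set x : 'rV[R]_d | forall i,
    `[0, 1]%classic (x ord0 i)] `&` [set x : 'rV[R]_d | l1norm x = 1]).
  exact: compact_closedI.
apply/seteqP; split=> x /=; rewrite /simplex/=.
  by move=> [x01 x1]; split=> // i; rewrite in_itv/=.
by move=> [x01 x1]; split=> // i; have := x01 i; rewrite in_itv/=.
Qed.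

Lemma fixed_point_exists W (sigma : R) : (0 < d)%N ->
  (forall i j k, 0 <= W i j k) -> 0 < sigma ->
  (forall j k, \sum_(i < d) W i j k = sigma) -> tensor_spread W < sigma ->
  exists2 x, simplex x & sigma *: x = replacement_map W x x.
Proof.
move=> d_gt0 hT s_gt0 hB hE.
pose F x := sigma^-1 *: replacement_map W x x.
have FS x : simplex x -> simplex (F x).
  move=> xS; apply: simplex_intro => [i|].
    by rewrite rowZE mulr_ge0 ?replacement_map_ge0// invr_ge0 ltW.
  under eq_bigr do rewrite rowZE.
  by rewrite -mulr_sumr (replacement_map_sum hB xS) mulVf// gt_eqF.
have S0 : @simplex R d !=set0.
  exists (delta_mx ord0 (Ordinal d_gt0)); apply: simplex_intro => [i|].
    by rewrite mxE ler0n.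
  rewrite (bigD1 (Ordinal d_gt0))//= mxE !eqxx/= big1 ?addr0// => i /negPf ne.
  by rewrite mxE ne.
have cF : continuous (fun x => l1norm (sigma *: (F x - x))).
  apply: continuous_l1norm => i.
  have -> : (fun x => (sigma *: (F x - x)) ord0 i) =
      (fun x => \sum_(c : 'I_d * 'I_d)
         x ord0 c.1 * x ord0 c.2 * W i c.1 c.2 - sigma * x ord0 i).
    apply/funext => x; rewrite rowZE rowBE rowZE replacement_mapE mulrBr mulrA.
    by rewrite divff ?mul1r// gt_eqF.
  have cx j : continuous (fun x : 'rV[R]_d => x ord0 j).
    exact: coord_continuous.
  have cS : continuous (fun x : 'rV[R]_d => \sum_(c : 'I_d * 'I_d)
      x ord0 c.1 * x ord0 c.2 * W i c.1 c.2).
    apply: continuous_big => [|c _]; first exact: add_continuous.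
    move=> y; apply: (continuousM (continuousM (cx c.1 y) (cx c.2 y))).
    exact: cst_continuous.
  move=> x; apply: (continuousB (cS x)).
  by apply: (continuousM _ (cx i x)); exact: cst_continuous.
(* [x] minimises |sigma (F x - x)|_1 over the simplex. *)
have [x] := compact_EVT_min S0 compact_simplex (continuous_subspaceT cF).
rewrite inE => xS xmin; exists x => //.
have := xmin (F x); rewrite inE => /(_ (FS _ xS)).
have FE y : sigma *: F y = replacement_map W y y.
  by rewrite scalerA divff ?scale1r// gt_eqF.
rewrite scalerBr [in leRHS]scalerBr !FE => le1.
have := le_trans le1 (replacement_map_lipschitz W (FS _ xS) xS).
rewrite -FE -scalerBr l1normZ gtr0_norm// => le2.
have : l1norm (F x - x) = 0.
  apply/eqP; rewrite eq_le l1norm_ge0 andbT leNgt; apply/negP => gt0.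
  by move: le2; rewrite ler_pM2r// leNgt hE.
by move/l1norm_eq0/eqP; rewrite subr_eq0 => /eqP Fx; have := FE x; rewrite Fx.
Qed.

End Contraction.

(** * Deterministic recursions *)

Section RealSequences.
Context {R : realType}.

(** Once e(n) <= h, one has a(n+1) - h <= (1 - g(n)) (a(n) - h), so that
    a(n) - h is at most a constant divided by 1 + s(n), where s(n) is the sum
    of [g] from that moment on; s(n) tends to infinity. *)
Lemma cvg0_damped_recursion (a g e : R^nat) :
  (forall n, 0 <= a n) -> (forall n, 0 <= g n <= 1) ->
  series g @ \oo --> +oo -> e @ \oo --> 0 ->
  (forall n, a n.+1 <= (1 - g n) * a n + g n * e n) ->
  a @ \oo --> 0.
Proof.
move=> a0 g01 g_oo e_0 rec; apply/cvgrPdist_le => eps eps_gt0.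
pose h := eps / 2; have h_gt0 : 0 < h by rewrite divr_gt0.
have [N _ eN] : \forall n \near \oo, e n <= h.
  have /cvgrPdist_le/(_ _ h_gt0) := e_0.
  apply: filterS => n; rewrite sub0r normrN => /(le_trans (ler_norm _)); exact.
pose C := `|a N - h|.
have bound n : (N <= n)%N ->
    (a n - h) * (1 + (series g n - series g N)) <= C /\
    0 <= series g n - series g N.
  elim: n => [|n IH].
    rewrite leqn0 => /eqP N0; rewrite N0 subrr addr0 mulr1 lexx.
    by rewrite /C N0 ler_norm.
  rewrite leq_eqVlt => /predU1P[<-|/[!ltnS] Nn].
    by rewrite subrr addr0 mulr1 lexx ler_norm.
  have [IH1 IH2] := IH Nn.
  have := eN n Nn; have := rec n; have /andP[g0 g1] := g01 n.
  rewrite /= => recn en.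
  have -> : series g n.+1 - series g N = series g n - series g N + g n.
    by rewrite {1}/series/= big_nat_recr//= addrAC.
  move: (series g n - series g N) IH1 IH2 => s IH1 IH2.
  split; last exact: addr_ge0.
  have an1 : a n.+1 - h <= (1 - g n) * (a n - h).
    rewrite lerBlDr (le_trans recn)//.
    have : g n * e n <= g n * h by rewrite ler_wpM2l.
    lra.
  have [neg|pos] := leP (a n.+1 - h) 0.
    apply: (le_trans _ (normr_ge0 _)); rewrite mulr_le0_ge0//.
    by rewrite !addr_ge0.
  have pn : 0 <= a n - h.
    rewrite leNgt; apply/negP => neg.
    have : (1 - g n) * (a n - h) <= 0.
      by rewrite mulr_ge0_le0 ?subr_ge0// ltW.
    by rewrite leNgt (lt_le_trans pos).
  apply: le_trans IH1.
  apply: (@le_trans _ _ ((1 - g n) * (a n - h) * (1 + (s + g n)))).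
    by rewrite ler_wpM2r// !addr_ge0.
  (* (1 - g n) * (1 + s + g n) <= 1 + s *)
  rewrite mulrAC mulrC ler_wpM2l//.
  have : 0 <= g n * s by rewrite mulr_ge0.
  have : 0 <= g n * g n by rewrite mulr_ge0.
  lra.
have /cvgryPge/(_ (C / h + series g N)) := g_oo.
apply: filterS2 (nbhs_infty_ge N) => n Nn sn.
rewrite sub0r normrN ger0_norm//.
have [b1 b2] := bound n Nn.
rewrite leNgt; apply/negP => lt.
have an : h < a n - h by rewrite /h; lra.
move: b1; rewrite leNgt => /negP; apply.
have Ch : C / h < 1 + (series g n - series g N).
  by move: sn; set x := C / h; lra.
apply: (@le_lt_trans _ _ (h * (C / h))); first by rewrite mulrC divfK ?gt_eqF.
apply: ltr_pM => //; first exact: ltW.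
by apply: divr_ge0; [exact: normr_ge0|exact: ltW].
Qed.

Context (s0 sigma : R).
Hypotheses (s0_gt0 : 0 < s0) (sigma_gt0 : 0 < sigma).

Let S n := s0 + sigma * n%:R.

Lemma linear_gt0 n : 0 < S n.
Proof. by rewrite ltr_pwDl// mulr_ge0// ltW. Qed.

Lemma series_inv_linear_dvg (k : R) : 0 < k ->
  series (fun n => k / S n.+1) @ \oo --> +oo.
Proof.
move=> k_gt0; pose c := k / (s0 + sigma).
have ss_gt0 : 0 < s0 + sigma by rewrite addr_gt0.
have c_gt0 : 0 < c by rewrite divr_gt0.
have harm : series (@harmonic R) @ \oo --> +oo.
  apply: nondecreasing_dvgn_lt; last exact: dvg_harmonic.
  by apply: nondecreasing_series => n _ _; exact: harmonic_ge0.
apply/cvgryPge => A; have /cvgryPge/(_ (A / c)) := harm.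
apply: filterS => n; rewrite ler_pdivrMr// => /le_trans; apply.
rewrite /series/= mulr_suml; apply: ler_sum => i _.
rewrite /c mulrCA ler_pM2l// -invfM lef_pV2 ?posrE ?linear_gt0 ?mulr_gt0//.
rewrite mulrDr [_ * sigma]mulrC /S lerD2r ler_peMl ?ler1n//.
exact: ltW.
Qed.

Lemma cvg_sqrt_inv_linear : Num.sqrt (S n)^-1 @[n --> \oo] --> 0.
Proof.
have S_oo : S n @[n --> \oo] --> +oo.
  apply/cvgryPge => A; have [N _ NP] := @nbhs_infty_ger R (A / sigma).
  exists N => // n /NP/=; rewrite ler_pdivrMr// mulrC => /le_trans; apply.
  by rewrite /S lerDr ltW.
have Sinv : (S n)^-1 @[n --> \oo] --> 0.
  by apply: (gtr0_cvgV0 _).2 => //; near=> n; exact: linear_gt0.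
by have := cvg_comp _ _ Sinv (@sqrt_continuous R 0); rewrite sqrtr0.
Unshelve. all: by end_near. Qed.

End RealSequences.

(** * The urn along finite sequences of draws *)

Section UrnPaths.
Context {R : realType} {d : nat}.
Variables (W : replacement_tensor R d) (u0 : 'rV[R]_d).
Local Notation pair := ('I_d * 'I_d)%type.
Implicit Types (h : seq pair) (c : pair) (f g : seq pair -> R).

(** State of the urn after the draws [h].  Sequences of draws list the most
    recent draw first. *)
Fixpoint path_state h : 'rV[R]_d :=
  if h is c :: h' then path_state h' + \row_i W i c.1 c.2 else u0.

(** Composition (vector of proportions) of the urn after the draws [h]. *)
Definition path_comp h : 'rV[R]_d :=
  (l1norm (path_state h))^-1 *: path_state h.

(** Conditional probability of the ordered pair [c] after the draws [h]. *)
Definition draw_weight h c : R :=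
  path_comp h ord0 c.1 * path_comp h ord0 c.2.

(** Probability of the sequence of draws [h]. *)
Fixpoint path_weight h : R :=
  if h is c :: h' then path_weight h' * draw_weight h' c else 1.

(** All sequences of [n] draws. *)
Fixpoint paths n : seq (seq pair) :=
  if n is n'.+1 then [seq c :: h | h <- paths n', c <- enum {: pair}]
  else [:: [::]].

(** Expectation of a function [f] of the first [n] draws. *)
Definition path_mean n f : R := \sum_(h <- paths n) path_weight h * f h.

Lemma mem_paths n h : (h \in paths n) = (size h == n).
Proof.
elim: n h => [|n IH] h; first by rewrite inE; case: h.
apply/allpairsP/idP => [[[h' c] /= [hn _ ->]]|].
  by rewrite /= eqSS -IH.
case: h => // c h; rewrite /= eqSS -IH => hn.
by exists (h, c); rewrite /= mem_enum.
Qed.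

(** Conditioning on the first [n] draws. *)
Lemma path_meanS n f : path_mean n.+1 f =
  path_mean n (fun h => \sum_c draw_weight h c * f (c :: h)).
Proof.
rewrite /path_mean /= big_allpairs_dep/=; apply: eq_bigr => h _.
rewrite big_enum/= mulr_sumr; apply: eq_bigr => c _.
by rewrite mulrA.
Qed.

Lemma path_meanD n f g :
  path_mean n (fun h => f h + g h) = path_mean n f + path_mean n g.
Proof. by rewrite -big_split/=; apply: eq_bigr => h _; rewrite mulrDr. Qed.

Lemma path_meanZ n (t : R) f :
  path_mean n (fun h => t * f h) = t * path_mean n f.
Proof. by rewrite mulr_sumr; apply: eq_bigr => h _; rewrite mulrCA. Qed.

Lemma path_mean_sum n (I : finType) (F : I -> seq pair -> R) :
  path_mean n (fun h => \sum_i F i h) = \sum_i path_mean n (F i).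
Proof.
by rewrite exchange_big/=; apply: eq_bigr => h _; rewrite mulr_sumr.
Qed.

Variable sigma : R.
Hypothesis W_ge0 : forall i j k, 0 <= W i j k.
Hypothesis sigma_gt0 : 0 < sigma.
Hypothesis W_sum : forall j k, \sum_(i < d) W i j k = sigma.
Hypothesis u0_ge0 : forall i, 0 <= u0 ord0 i.
Hypothesis u0_gt0 : 0 < l1norm u0.

(* Total mass of the urn after [n] draws. *)
Let mass n := l1norm u0 + sigma * n%:R.

Lemma path_state_ge0 h i : 0 <= path_state h ord0 i.
Proof. by elim: h => //= c h IH; rewrite !mxE addr_ge0. Qed.

Lemma path_state_l1norm h : l1norm (path_state h) = mass (size h).
Proof.
elim: h => [|c h IH]; first by rewrite /mass mulr0 addr0.
rewrite /mass /= mulrS mulrDr mulr1 addrCA -/(mass _) -IH.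
rewrite -(W_sum c.1 c.2) addrC /l1norm -big_split/=; apply: eq_bigr => i _.
by rewrite !mxE !ger0_norm ?addr_ge0 ?path_state_ge0.
Qed.

Lemma mass_gt0 n : 0 < mass n.
Proof. exact: linear_gt0. Qed.

Lemma path_comp_simplex h : simplex (path_comp h).
Proof.
have n0 : 0 < l1norm (path_state h) by rewrite path_state_l1norm mass_gt0.
apply: simplex_intro => [i|].
  by rewrite rowZE mulr_ge0 ?invr_ge0 ?l1norm_ge0 ?path_state_ge0.
under eq_bigr do rewrite rowZE.
rewrite -mulr_sumr; rewrite [X in _ * X](_ : _ = l1norm (path_state h)).
  by rewrite mulVf// gt_eqF.
by apply: eq_bigr => i _; rewrite ger0_norm// path_state_ge0.
Qed.

Lemma draw_weight_ge0 h c : 0 <= draw_weight h c.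
Proof. by rewrite mulr_ge0// simplex_ge0//; exact: path_comp_simplex. Qed.

Lemma draw_weight_sum h : \sum_c draw_weight h c = 1.
Proof. by rewrite simplex_sum_pair//; exact: path_comp_simplex. Qed.

Lemma path_weight_ge0 h : 0 <= path_weight h.
Proof. by elim: h => //= c h IH; rewrite mulr_ge0// draw_weight_ge0. Qed.

Lemma path_mean_le n f g : (forall h, size h = n -> f h <= g h) ->
  path_mean n f <= path_mean n g.
Proof.
move=> fg; rewrite /path_mean big_seq [leRHS]big_seq; apply: ler_sum => h.
by rewrite mem_paths => /eqP hn; rewrite ler_wpM2l ?path_weight_ge0 ?fg.
Qed.

Lemma path_mean_ge0 n f : (forall h, 0 <= f h) -> 0 <= path_mean n f.
Proof.
by move=> f0; apply: sumr_ge0 => h _; rewrite mulr_ge0 ?path_weight_ge0.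
Qed.

Lemma path_mean_cst n (t : R) : path_mean n (fun=> t) = t.
Proof.
elim: n => [|n IH]; first by rewrite /path_mean /= big_seq1/= mul1r.
rewrite path_meanS -[RHS]IH; congr path_mean; apply/funext => h.
by rewrite -mulr_suml draw_weight_sum mul1r.
Qed.

(** Conditional expectation of the next increment of the urn, given the draws
    made so far. *)
Definition drift h := replacement_map W (path_comp h) (path_comp h).

(** Sum of the centred increments along a sequence of draws: the martingale
    part of the urn. *)
Fixpoint path_noise h : 'rV[R]_d :=
  if h is c :: h' then
    path_noise h' + (\row_i W i c.1 c.2 - drift h')
  else 0.

Lemma tensor_le_sigma i j k : W i j k <= sigma.
Proof. by rewrite -(W_sum j k) (bigD1 i)//= lerDl sumr_ge0. Qed.

Lemma drift_bounds h i : 0 <= drift h ord0 i <= sigma.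
Proof.
have xS := path_comp_simplex h.
rewrite replacement_map_ge0//= -(replacement_map_sum W_sum xS).
rewrite (bigD1 i)//= lerDl sumr_ge0// => j _.
exact: replacement_map_ge0.
Qed.

(** The cross term vanishes as increments are centred given the past; each
    increment is a difference of two numbers of [0, sigma]. *)
Lemma noise_second_moment n i :
  path_mean n (fun h => path_noise h ord0 i ^+ 2) <= sigma ^+ 2 * n%:R.
Proof.
elim: n => [|n IH].
  by rewrite /path_mean/= big_seq1/= mxE expr0n/= !mulr0.
rewrite path_meanS -natr1 mulrDr mulr1.
apply: (@le_trans _ _
  (path_mean n (fun h => path_noise h ord0 i ^+ 2 + sigma ^+ 2))); last first.
  by rewrite path_meanD path_mean_cst lerD2r.
apply: path_mean_le => h _.
pose m c := W i c.1 c.2 - drift h ord0 i; pose g := path_noise h ord0 i.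
have mE : \sum_c draw_weight h c * m c = 0.
  under eq_bigr do rewrite mulrBr.
  rewrite sumrB -mulr_suml draw_weight_sum mul1r /drift replacement_mapE.
  by rewrite subrr.
apply: (@le_trans _ _ (\sum_c draw_weight h c * (g ^+ 2 + sigma ^+ 2) +
    2 * g * \sum_c draw_weight h c * m c)); last first.
  by rewrite mE mulr0 addr0 -mulr_suml draw_weight_sum mul1r.
rewrite mulr_sumr -big_split/=; apply: ler_sum => c _.
have -> : (path_noise h + (\row_i0 W i0 c.1 c.2 - drift h)) ord0 i = g + m c.
  by rewrite /g /m !mxE.
have : m c ^+ 2 <= sigma ^+ 2.
  rewrite -[leLHS]real_normK ?num_real// ler_pXn2r// ?nnegrE ?(ltW sigma_gt0)//.
  have /andP[d0 d1] := drift_bounds h i.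
  have w0 := W_ge0 i c.1 c.2; have w1 := tensor_le_sigma i c.1 c.2.
  by rewrite ler_norml /m; apply/andP; split; lra.
move=> m2; have := ler_wpM2l (draw_weight_ge0 h c) m2.
move: (draw_weight h c) (m c) => p x; lra.
Qed.

(** With t the right-hand side, |y| <= t / 2 + y^2 / (2 t) reduces the bound
    to the second moment. *)
Lemma noise_first_moment n i :
  path_mean n (fun h => `|path_noise h ord0 i|) <= Num.sqrt (sigma * mass n).
Proof.
set t := Num.sqrt _.
have sS_gt0 : 0 < sigma * mass n by rewrite mulr_gt0// mass_gt0.
have t_gt0 : 0 < t by rewrite sqrtr_gt0.
have t2 : t ^+ 2 = sigma * mass n by rewrite sqr_sqrtr// ltW.
have le2 : path_mean n (fun h => t / 2 + (2 * t)^-1 * path_noise h ord0 i ^+ 2)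
    <= t.
  rewrite path_meanD path_mean_cst path_meanZ -lerBrDl.
  have -> : t - t / 2 = (2 * t)^-1 * t ^+ 2.
    by field; rewrite gt_eqF.
  rewrite ler_wpM2l ?invr_ge0 ?mulr_ge0 ?(ltW t_gt0)//.
  apply: (le_trans (noise_second_moment n i)).
  by rewrite t2 /mass mulrDr mulrA -expr2 lerDr mulr_ge0 ?ltW.
apply: le_trans le2; apply: path_mean_le => h _.
move: (path_noise h ord0 i) => x.
have -> : t / 2 + (2 * t)^-1 * x ^+ 2 = (t ^+ 2 + `|x| ^+ 2) / (2 * t).
  by rewrite real_normK ?num_real//; field; rewrite gt_eqF.
rewrite ler_pdivlMr ?mulr_gt0//.
have := sqr_ge0 (t - `|x|); rewrite sqrrB -mulr_natr.
move: `|x| => y; lra.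
Qed.

Variable x : 'rV[R]_d.
Hypotheses (xS : simplex x) (x_fixed : sigma *: x = replacement_map W x x).

(** Unnormalised deviation of the urn from the fixed point, with the noise
    subtracted. *)
Definition path_residual h : 'rV[R]_d :=
  path_state h - mass (size h) *: x - path_noise h.

Let rho := tensor_spread W.

Lemma path_deviation h : path_comp h - x =
  (mass (size h))^-1 *: (path_residual h + path_noise h).
Proof.
rewrite /path_residual subrK scalerBr scalerA mulVf ?gt_eqF ?mass_gt0//.
by rewrite scale1r /path_comp path_state_l1norm.
Qed.

Lemma path_deviation_le h : l1norm (path_comp h - x) <=
  (mass (size h))^-1 * (l1norm (path_residual h) + l1norm (path_noise h)).
Proof.
rewrite path_deviation l1normZ gtr0_norm ?invr_gt0 ?mass_gt0//.
by rewrite ler_wpM2l ?invr_ge0 ?l1normD// ltW// mass_gt0.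
Qed.

(** The residual does not depend directly on the last draw [c]: its increment
    is F(X) - F(x), to which the Lipschitz bound applies. *)
Lemma path_residual_step c h :
  l1norm (path_residual (c :: h)) <=
  l1norm (path_residual h) + rho / mass (size h) *
    (l1norm (path_residual h) + l1norm (path_noise h)).
Proof.
have -> : path_residual (c :: h) =
    path_residual h + (drift h - replacement_map W x x).
  rewrite -x_fixed /path_residual /=.
  have -> : mass (size h).+1 = mass (size h) + sigma.
    by rewrite /mass mulrS mulrDr mulr1 addrCA addrC.
  apply/rowP => i; rewrite /drift !mxE; ring.
apply: (le_trans (l1normD _ _)); rewrite lerD2l.
apply: le_trans (replacement_map_lipschitz W (path_comp_simplex h) xS) _.
rewrite -/rho -mulrA ler_wpM2l ?path_deviation_le//.
exact: tensor_spread_ge0.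
Qed.

Hypothesis W_spread : rho < sigma.

(* Normalised expected residual, and the forcing term of its recursion. *)
Let a n := path_mean n (fun h => l1norm (path_residual h)) / mass n.
Let e n := rho / (sigma - rho) * (d%:R * Num.sqrt sigma * Num.sqrt (mass n)^-1).

Lemma noise_l1_moment n :
  path_mean n (fun h => l1norm (path_noise h)) / mass n <=
  d%:R * Num.sqrt sigma * Num.sqrt (mass n)^-1.
Proof.
rewrite ler_pdivrMr ?mass_gt0// path_mean_sum.
apply: (@le_trans _ _ (\sum_(i < d) Num.sqrt (sigma * mass n))).
  by apply: ler_sum => i _; exact: noise_first_moment.
rewrite sumr_const card_ord -[leLHS]mulr_natl -!mulrA ler_wpM2l//.
rewrite sqrtrM ?(ltW sigma_gt0)// ler_wpM2l ?sqrtr_ge0//.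
rewrite -[X in _ <= _ * X](sqr_sqrtr (ltW (mass_gt0 n))).
rewrite sqrtrV ?(ltW (mass_gt0 n))//.
by rewrite expr2 mulrA mulVf ?mul1r// gt_eqF// sqrtr_gt0 mass_gt0.
Qed.

Lemma mean_residual_step n :
  a n.+1 <= (1 - (sigma - rho) / mass n.+1) * a n +
            (sigma - rho) / mass n.+1 * e n.
Proof.
have Sn := mass_gt0 n; have Sn1 := mass_gt0 n.+1.
have rho_ge0 : 0 <= rho := tensor_spread_ge0 W.
have SE : mass n.+1 = mass n + sigma.
  by rewrite /mass mulrS mulrDr mulr1 addrCA addrC.
pose v := path_mean n (fun h => l1norm (path_residual h)).
pose w := path_mean n (fun h => l1norm (path_noise h)).
have step : path_mean n.+1 (fun h => l1norm (path_residual h)) <=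
    v + rho / mass n * (v + w).
  rewrite path_meanS /v /w -path_meanD -path_meanZ -path_meanD.
  apply: path_mean_le => h hn.
  apply: (@le_trans _ _ (\sum_c draw_weight h c * (l1norm (path_residual h) +
      rho / mass n * (l1norm (path_residual h) + l1norm (path_noise h))))).
    apply: ler_sum => c _; rewrite ler_wpM2l ?draw_weight_ge0// -hn.
    exact: path_residual_step.
  by rewrite -mulr_suml draw_weight_sum mul1r.
rewrite {1}/a ler_pdivrMr// (le_trans step)//.
have wle := noise_l1_moment n; rewrite -/w in wle.
have sr : 0 < sigma - rho by rewrite subr_gt0.
have -> : ((1 - (sigma - rho) / mass n.+1) * a n +
    (sigma - rho) / mass n.+1 * e n) * mass n.+1 = v + rho / mass n * v +
      rho * (d%:R * Num.sqrt sigma * Num.sqrt (mass n)^-1).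
  rewrite /e /a -/v SE; field.
  by rewrite -SE !gt_eqF.
rewrite mulrDr addrA lerD2l -mulrA ler_wpM2l// mulrC.
exact: wle.
Qed.

Lemma mean_residual_cvg0 : a @ \oo --> 0.
Proof.
have rho_ge0 : 0 <= rho := tensor_spread_ge0 W.
have sr : 0 < sigma - rho by rewrite subr_gt0.
apply: (@cvg0_damped_recursion _ _ (fun n => (sigma - rho) / mass n.+1) e).
- move=> n; rewrite divr_ge0 ?(ltW (mass_gt0 n))// path_mean_ge0// => h.
  exact: l1norm_ge0.
- move=> n; rewrite divr_ge0 ?(ltW (mass_gt0 _)) ?(ltW sr)//=.
  rewrite ler_pdivrMr ?mass_gt0// mul1r /mass mulrS mulrDr mulr1.
  have : 0 <= sigma * n%:R by rewrite mulr_ge0// ltW.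
  by move: u0_gt0; lra.
- exact: series_inv_linear_dvg.
- pose k := rho / (sigma - rho) * (d%:R * Num.sqrt sigma).
  rewrite -[X in _ --> X](mulr0 k).
  rewrite (_ : e = fun n => k * Num.sqrt (mass n)^-1); last first.
    by apply/funext => n; rewrite /e /k !mulrA.
  by apply: cvgMr; exact: cvg_sqrt_inv_linear.
- exact: mean_residual_step.
Qed.

Lemma mean_deviation_cvg0 :
  path_mean n (fun h => l1norm (path_comp h - x)) @[n --> \oo] --> 0.
Proof.
pose b n := a n + d%:R * Num.sqrt sigma * Num.sqrt (mass n)^-1.
have b0 : b @ \oo --> 0.
  rewrite -[X in _ --> X](addr0 0).
  apply: cvgD; first exact: mean_residual_cvg0.
  rewrite -[X in _ --> X](mulr0 (d%:R * Num.sqrt sigma)).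
  by apply: cvgMr; exact: cvg_sqrt_inv_linear.
apply: (squeeze_cvgr _ (cvg_cst 0) b0); near=> n.
rewrite path_mean_ge0/= => [|h]; last exact: l1norm_ge0.
apply: (@le_trans _ _ (path_mean n (fun h => (mass n)^-1 *
    (l1norm (path_residual h) + l1norm (path_noise h))))).
  by apply: path_mean_le => h <-; exact: path_deviation_le.
rewrite path_meanZ path_meanD mulrDr lerD//; first by rewrite mulrC.
by rewrite mulrC noise_l1_moment.
Unshelve. all: by end_near. Qed.

End UrnPaths.

(** * Law of the draws and conclusion *)

Section DrawHistory.
Context {d : nat}.
Local Notation pair := ('I_d * 'I_d)%type.

(** The first [n] draws at the outcome [w], most recent first. *)
Fixpoint draw_path {T : Type} (C1 C2 : nat -> T -> 'I_d) n (w : T) : seq pair :=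
  if n is n'.+1 then (C1 n' w, C2 n' w) :: draw_path C1 C2 n' w else [::].

Lemma size_draw_path {T : Type} (C1 C2 : nat -> T -> 'I_d) n w :
  size (draw_path C1 C2 n w) = n.
Proof. by elim: n => //= n ->. Qed.

Lemma draw_path_preimageS {T : Type} (C1 C2 : nat -> T -> 'I_d) n c h :
  [set w | draw_path C1 C2 n.+1 w = c :: h] =
  (C1 n @^-1` [set c.1] `&` C2 n @^-1` [set c.2]) `&`
  [set w | draw_path C1 C2 n w = h].
Proof.
apply/seteqP; split=> w /=.
  by move=> [<- <-].
by case: c => k l /= [[-> ->] ->].
Qed.

Lemma measurable_draw_path {disp : measure_display} {T : measurableType disp}
    (C1 C2 : nat -> T -> 'I_d) n (h : seq pair) :
  (forall m k, (m < n)%N -> measurable (C1 m @^-1` [set k])) ->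
  (forall m k, (m < n)%N -> measurable (C2 m @^-1` [set k])) ->
  measurable [set w | draw_path C1 C2 n w = h].
Proof.
elim: n h => [|n IH] h m1 m2.
  case: h => [|c h].
    rewrite (_ : [set _ | _] = setT); first exact: measurableT.
    by apply/seteqP; split.
  rewrite (_ : [set _ | _] = set0); first exact: measurable0.
  by apply/seteqP; split.
case: h => [|c h].
  rewrite (_ : [set _ | _] = set0); first exact: measurable0.
  by apply/seteqP; split.
rewrite draw_path_preimageS; apply: measurableI.
  by apply: measurableI; [exact: m1|exact: m2].
by apply: IH => m k mn; [apply: m1|apply: m2]; rewrite ltnS ltnW.
Qed.

Context {R : realType} {disp : measure_display} {T : measurableType disp}.
Variables (W : replacement_tensor R d) (P : probability T R) (u0 : 'rV[R]_d)
  (U : nat -> T -> 'rV[R]_d) (C1 C2 : nat -> T -> 'I_d).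
Hypothesis urn : two_drawing_urn W P u0 U C1 C2.

(** Measurability with respect to the generated sigma-algebra is an instance of
    [measurable_draw_path] on the same carrier. *)
Lemma history_draw_path n h :
  urn_history U C1 C2 n [set w | draw_path C1 C2 n w = h].
Proof.
rewrite /urn_history; set G := (X in <<s X >>).
apply: (@measurable_draw_path _ (g_sigma_algebraType G) C1 C2) => m k mn;
  apply: sub_sigma_algebra; right; exists m, k; split=> //; by [left|right].
Qed.

Lemma urn_draw_path n w : U n w = path_state W u0 (draw_path C1 C2 n w).
Proof.
elim: n => [|n IH]; first exact: urn_init urn w.
by apply/rowP => i; rewrite (urn_step urn) /= -IH !mxE.
Qed.

Hypothesis u0_ge0 : forall i, 0 <= u0 ord0 i.
Hypothesis W_ge0 : forall i j k, 0 <= W i j k.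

Lemma proportion_path_comp h k :
  proportion (path_state W u0 h) k = path_comp W u0 h ord0 k.
Proof.
rewrite /proportion /path_comp rowZE mulrC; congr (_^-1 * _).
by apply: eq_bigr => i _; rewrite ger0_norm// path_state_ge0.
Qed.

Lemma measurable_urn_path n h : measurable [set w | draw_path C1 C2 n w = h].
Proof.
by apply: measurable_draw_path => m k _;
  [exact: draw1_measurable urn m k|exact: draw2_measurable urn m k].
Qed.

(** The state of the urn is constant on the event that the first draws are
    [h], so conditioning on the history multiplies by the draw weight. *)
Lemma prob_draw_path n h : size h = n ->
  P [set w | draw_path C1 C2 n w = h] = (path_weight W u0 h)%:E.
Proof.
elim: n h => [|n IH] [|c h]//= => [_|[hn]].
  rewrite (_ : [set _ | _] = setT) ?probability_setT//.
  by apply/seteqP; split.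
rewrite draw_path_preimageS.
have [_ _ /(_ _ (history_draw_path h)) <-] := draws_independent urn n c.1 c.2.
rewrite (eq_integral (cst (draw_weight W u0 h c)%:E)); last first.
  move=> w; rewrite inE => /= <-.
  by rewrite urn_draw_path !proportion_path_comp.
rewrite integral_cst; last exact: measurable_urn_path.
transitivity ((draw_weight W u0 h c)%:E * (path_weight W u0 h)%:E)%E.
  by congr (_ * _)%E; exact: IH.
by rewrite -EFinM mulrC.
Qed.

(** Markov inequality, by subadditivity over the finitely many sequences of
    [n] draws. *)
Lemma prob_path_le n (eps : R) (f : seq pair -> R) : 0 < eps ->
  (forall h, 0 <= path_weight W u0 h) -> (forall h, 0 <= f h) ->
  (P [set w | (eps < f (draw_path C1 C2 n w))%R] <=
   (eps^-1 * path_mean W u0 n f)%:E)%E.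
Proof.
move=> eps_gt0 q_ge0 f_ge0.
have mA h : measurable [set w | draw_path C1 C2 n w = h].
  exact: measurable_urn_path.
pose B (s : seq (seq pair)) :=
  [set w | draw_path C1 C2 n w \in s /\ eps < f (draw_path C1 C2 n w)].
have union_le s : {in s, forall h, size h = n} -> measurable (B s) /\
    (P (B s) <= (eps^-1 * \sum_(h <- s) path_weight W u0 h * f h)%:E)%E.
  elim: s => [_|h s IH hs].
    rewrite (_ : B _ = set0); last by apply/seteqP; split=> // w [].
    by rewrite measure0 big_nil mulr0.
  have hn : size h = n by apply: hs; rewrite mem_head.
  have [|ms le_s] := IH.
    by move=> h' h's; apply: hs; rewrite inE h's orbT.
  rewrite big_cons mulrDr EFinD.
  have [lt|ge] := ltP eps (f h); last first.
    rewrite (_ : B (h :: s) = B s).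
      split=> //; apply: (le_trans le_s); rewrite leeDr// lee_fin.
      by apply: mulr_ge0; [rewrite invr_ge0 ltW|exact: mulr_ge0].
    apply/seteqP; split=> w [/= ws lt']; split=> //; last first.
      by rewrite inE ws orbT.
    by move: ws lt'; rewrite inE => /predU1P[->|//]; rewrite ltNge ge.
  rewrite (_ : B (h :: s) = [set w | draw_path C1 C2 n w = h] `|` B s).
    split; first exact: measurableU.
    apply: (le_trans (measureU2 _ _ _)) => //; apply: leeD => //.
    apply: (@le_trans _ _ (path_weight W u0 h)%:E).
      by rewrite -(prob_draw_path hn).
    rewrite lee_fin mulrCA ler_peMr//.
    by rewrite mulrC ler_pdivlMr// mul1r ltW.
  apply/seteqP; split=> w /=.
    by move=> [/[!inE]/predU1P[->|ws] lt']; [left|right].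
  move=> [wh|[ws lt']]; first by rewrite /B/= wh mem_head.
  by split=> //; rewrite inE ws orbT.
have [|_] := union_le (paths n).
  by move=> h; rewrite mem_paths => /eqP.
apply: le_trans; rewrite le_eqVlt; apply/orP; left; apply/eqP.
congr (P _); apply/seteqP; split=> w /=; last by case.
by move=> lt; split=> //; rewrite mem_paths size_draw_path.
Qed.

End DrawHistory.

Theorem theorem1p3 (R : realType) (d : nat) (d_ge1 : (1 <= d)%N)
    (W : replacement_tensor R d) (sigma : R)
    (hT : forall i j k, 0 <= W i j k)
    (sigma_gt0 : 0 < sigma)
    (hB : forall j k, \sum_(i < d) W i j k = sigma)
    (hE : tensor_spread W < sigma) :
  (exists! x : 'rV[R]_d, simplex x /\ sigma *: x = replacement_map W x x) /\
  (forall x : 'rV[R]_d, simplex x -> sigma *: x = replacement_map W x x ->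
   forall (disp : measure_display) (T : measurableType disp)
     (P : probability T R) (u0 : 'rV[R]_d)
     (U : nat -> T -> 'rV[R]_d) (C1 C2 : nat -> T -> 'I_d),
   two_drawing_urn W P u0 U C1 C2 ->
   0 < l1norm u0 ->
   cvg_in_probability P (fun n w => (l1norm (U n w))^-1 *: U n w) x).
Proof.
split.
  have [x xS xfix] := fixed_point_exists d_ge1 hT sigma_gt0 hB hE.
  exists x; split=> // y [yS yfix].
  exact: fixed_point_unique hE xS xfix yS yfix.
move=> x xS xfix disp T P u0 U C1 C2 urn u0_gt0 eps eps_gt0.
have u0_ge0 i : 0 <= u0 ord0 i.
  by rewrite -(urn_init urn point); exact: urn_ge0 urn _ _ _.
have q_ge0 := path_weight_ge0 hT sigma_gt0 hB u0_ge0 u0_gt0.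
pose m n := path_mean W u0 n (fun h => l1norm (path_comp W u0 h - x)).
have m0 : (eps^-1 * m n)%:E @[n --> \oo] --> (0 : \bar R)%E.
  apply: cvg_EFin; first by near=> n.
  rewrite -[X in _ --> X](mulr0 eps^-1); apply: cvgMr.
  exact: mean_deviation_cvg0 hT sigma_gt0 hB u0_ge0 u0_gt0 _ xS xfix hE.
apply: (squeeze_cvge _ (cvg_cst 0%E) m0); near=> n.
rewrite measure_ge0/=.
have := prob_path_le urn u0_ge0 hT n eps_gt0 q_ge0
  (fun h => l1norm_ge0 (path_comp W u0 h - x)).
apply: le_trans; rewrite le_eqVlt; apply/orP; left; apply/eqP.
by congr (P _); apply/funext => w /=; rewrite (urn_draw_path urn).
Unshelve. all: by end_near. Qed.
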